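(* Let $A\in\mathbb{R}^{n\times n}$. If there exists $\nu\in(0,1)$ such that $\|I-\nu A\|<1-\nu$, then for every $b\in\mathbb{R}^n$ the absolute value equation $Ax-|x|-b=0$ has a unique solution $x\in\mathbb{R}^n$.
   Context: For $x\in\mathbb{R}^n$, $|x|$ denotes the component-wise absolute value of $x$. $I$ is the identity matrix, and $\|\cdot\|$ of a matrix denotes its $2$-norm (spectral norm). *)

(* Defs.v *)
From mathcomp Require Import all_boot all_order all_algebra.
From mathcomp Require Import boolp classical_sets reals.
Set Implicit Arguments.
Unset Strict Implicit.
Unset Printing Implicit Defensive.
Import Order.TTheory GRing.Theory Num.Theory.
Local Open Scope classical_set_scope.
Local Open Scope ring_scope.

(* MathComp-Analysis puts the max norm on matrices, so the Euclidean norm of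
   vectors and the induced spectral norm of matrices are defined here. *)
Definition vnorm2 (R : realType) (n : nat) (x : 'cV[R]_n) : R :=
  Num.sqrt (\sum_(i < n) x i 0 ^+ 2).

(* The closed unit ball, rather than the unit sphere, keeps the set nonempty
   when n = 0. *)
Definition mxnorm2 (R : realType) (m n : nat) (A : 'M[R]_(m, n)) : R :=
  sup [set vnorm2 (A *m x) | x in [set x : 'cV[R]_n | vnorm2 x <= 1]].

Definition absmx (R : realType) (m n : nat) (A : 'M[R]_(m, n)) : 'M[R]_(m, n) :=
  map_mx Num.norm A.

(* [sup] defaults to 0 on unbounded sets; that case never arises in
   [mxnorm2]. *)
Lemma mxnorm2_has_sup (R : realType) (m n : nat) (A : 'M[R]_(m, n)) :
  has_sup [set vnorm2 (A *m x) | x in [set x : 'cV[R]_n | vnorm2 x <= 1]].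
Proof.
split.
  exists (vnorm2 (A *m 0)), 0 => //=.
  by rewrite /vnorm2 big1 ?sqrtr0 ?ler01 // => i _; rewrite mxE expr0n.
exists (Num.sqrt (\sum_(i < m) (\sum_(j < n) `|A i j|) ^+ 2)) => _ [x /= x1 <-].
rewrite /vnorm2 ler_sqrt; last by apply: sumr_ge0 => i _; apply: sqr_ge0.
apply: ler_sum => i _; rewrite -real_normK ?num_real // ler_sqr ?nnegrE //;
  last by apply: sumr_ge0.
rewrite mxE (le_trans (ler_norm_sum _ _ _)) //; apply: ler_sum => j _.
rewrite normrM ler_piMr // (le_trans _ x1) // -sqrtr_sqr ler_sqrt;
  last by apply: sumr_ge0 => k _; apply: sqr_ge0.
by rewrite (bigD1 j) //= lerDl sumr_ge0 // => k _; apply: sqr_ge0.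
Qed.

(* Main.v *)
Require Import Defs.
From mathcomp Require Import all_boot all_order all_algebra.
From mathcomp Require Import boolp classical_sets reals.
From mathcomp Require Import topology normedtype sequences realfun.
From mathcomp Require Import ring.
Import Order.TTheory GRing.Theory Num.Theory.
Import numFieldNormedType.Exports.
Local Open Scope ring_scope.

(** Write [M := 1%:M - nu *: A].  Multiplying the equation by [nu] and moving
[nu *: A *m x] to the other side turns it into the fixed-point equation
[x = T x] with [T x := M *m x + nu *: absmx x + nu *: b].  The matrix part of
[T] is Lipschitz with constant [mxnorm2 M] ([vnorm2_mulmx]), and taking absolute
values is nonexpansive for the Euclidean norm ([vnorm2_absmxB]), so [T] is
Lipschitz with constant [mxnorm2 M + nu], which is below [1] by hypothesis.  The
contraction principle ([vnorm2_contraction_fixpoint]) then gives exactly one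
fixed point.

The canonical norm on matrices is the max norm, for which [T] need not be a
contraction.  The contraction principle is therefore applied to [vnorm2]:
the iterates of [T] have geometrically small increments, so each coordinate
converges, and coordinatewise convergence implies convergence in [vnorm2]
because there are finitely many coordinates. *)

Lemma vnorm2_ge0 (R : realType) (n : nat) (x : 'cV[R]_n) : 0 <= vnorm2 x.
Proof. exact: sqrtr_ge0. Qed.

Lemma sqr_vnorm2 (R : realType) (n : nat) (x : 'cV[R]_n) :
  vnorm2 x ^+ 2 = \sum_(i < n) x i 0 ^+ 2.
Proof. by rewrite sqr_sqrtr // sumr_ge0 // => i _; apply: sqr_ge0. Qed.

Lemma vnorm2_ge_coord (R : realType) (n : nat) (x : 'cV[R]_n) (i : 'I_n) :
  `|x i 0| <= vnorm2 x.
Proof.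
rewrite -ler_sqr ?nnegrE ?vnorm2_ge0 // sqr_vnorm2 real_normK ?num_real //.
by rewrite (bigD1 i) //= lerDl sumr_ge0 // => k _; apply: sqr_ge0.
Qed.

Lemma vnorm2_le0 (R : realType) (n : nat) (x : 'cV[R]_n) :
  vnorm2 x <= 0 -> x = 0.
Proof.
move=> x0; apply/matrixP => i j; rewrite ord1 mxE; apply/eqP.
by rewrite -normr_le0 (le_trans (vnorm2_ge_coord _ _ x i)).
Qed.

Lemma vnorm2_0 (R : realType) (n : nat) : vnorm2 (0 : 'cV[R]_n) = 0.
Proof. by rewrite /vnorm2 big1 ?sqrtr0 // => i _; rewrite mxE expr0n. Qed.

Lemma vnorm2Z (R : realType) (n : nat) (a : R) (x : 'cV[R]_n) :
  vnorm2 (a *: x) = `|a| * vnorm2 x.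
Proof.
rewrite /vnorm2 -sqrtr_sqr -sqrtrM ?sqr_ge0 // mulr_sumr.
by congr Num.sqrt; apply: eq_bigr => i _; rewrite mxE exprMn.
Qed.

Lemma vnorm2B (R : realType) (n : nat) (x y : 'cV[R]_n) :
  vnorm2 (x - y) = vnorm2 (y - x).
Proof. by rewrite -opprB -scaleN1r vnorm2Z normrN1 mul1r. Qed.

(** For nonzero [x] and [y], the squares of the coordinates of
[vnorm2 y *: x - vnorm2 x *: y] add up to a positive multiple of the difference
between the two sides. *)
Lemma cauchy_schwarz_vnorm2 (R : realType) (n : nat) (x y : 'cV[R]_n) :
  \sum_(i < n) x i 0 * y i 0 <= vnorm2 x * vnorm2 y.
Proof.
have [x0|x0] := lerP (vnorm2 x) 0.
  rewrite (vnorm2_le0 _ _ _ x0) vnorm2_0 mul0r big1 // => i _.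
  by rewrite mxE mul0r.
have [y0|y0] := lerP (vnorm2 y) 0.
  rewrite (vnorm2_le0 _ _ _ y0) vnorm2_0 mulr0 big1 // => i _.
  by rewrite mxE mulr0.
have xy0 : 0 < vnorm2 x * vnorm2 y *+ 2 by rewrite pmulrn_lgt0 // mulr_gt0.
have : 0 <= \sum_(i < n) (vnorm2 y * x i 0 - vnorm2 x * y i 0) ^+ 2.
  by rewrite sumr_ge0 // => i _; apply: sqr_ge0.
have -> : \sum_(i < n) (vnorm2 y * x i 0 - vnorm2 x * y i 0) ^+ 2 =
    vnorm2 x * vnorm2 y *+ 2 *
    (vnorm2 x * vnorm2 y - \sum_(i < n) x i 0 * y i 0).
  transitivity (vnorm2 y ^+ 2 * (\sum_(i < n) x i 0 ^+ 2)
    - vnorm2 x * vnorm2 y *+ 2 * (\sum_(i < n) x i 0 * y i 0)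
    + vnorm2 x ^+ 2 * (\sum_(i < n) y i 0 ^+ 2)).
    rewrite !mulr_sumr -sumrB -big_split /=; apply: eq_bigr => i _.
    by ring.
  by rewrite -!sqr_vnorm2; ring.
by rewrite pmulr_rge0 // subr_ge0.
Qed.

Lemma vnorm2D (R : realType) (n : nat) (x y : 'cV[R]_n) :
  vnorm2 (x + y) <= vnorm2 x + vnorm2 y.
Proof.
rewrite -ler_sqr ?nnegrE ?addr_ge0 ?vnorm2_ge0 // sqrrD !sqr_vnorm2.
have -> : \sum_(i < n) (x + y) i 0 ^+ 2 = \sum_(i < n) x i 0 ^+ 2 +
   (\sum_(i < n) x i 0 * y i 0) *+ 2 + \sum_(i < n) y i 0 ^+ 2.
  by rewrite -sumrMnl -!big_split; apply: eq_bigr => i _; rewrite mxE sqrrD.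
by rewrite lerD2r lerD2l lerMn2r cauchy_schwarz_vnorm2.
Qed.

(** Coordinatewise, this is the reverse triangle inequality. *)
Lemma vnorm2_absmxB (R : realType) (n : nat) (x y : 'cV[R]_n) :
  vnorm2 (absmx x - absmx y) <= vnorm2 (x - y).
Proof.
rewrite -ler_sqr ?nnegrE ?vnorm2_ge0 // !sqr_vnorm2.
apply: ler_sum => i _; rewrite !mxE -[leRHS]real_normK ?num_real //.
by rewrite -[leLHS]real_normK ?num_real // ler_sqr ?nnegrE // ler_dist_dist.
Qed.

Lemma mxnorm2_ge0 (R : realType) (m n : nat) (A : 'M[R]_(m, n)) :
  0 <= mxnorm2 A.
Proof.
apply: (ub_le_sup (proj2 (mxnorm2_has_sup A))).
by exists 0; rewrite /= ?mulmx0 vnorm2_0 // ler01.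
Qed.

(** By homogeneity it is enough to look at [(vnorm2 x)^-1 *: x], which lies in
the unit ball over which [mxnorm2] takes its supremum. *)
Lemma vnorm2_mulmx (R : realType) (m n : nat) (A : 'M[R]_(m, n)) (x : 'cV_n) :
  vnorm2 (A *m x) <= mxnorm2 A * vnorm2 x.
Proof.
have [x0|x0] := lerP (vnorm2 x) 0.
  by rewrite (vnorm2_le0 _ _ _ x0) mulmx0 !vnorm2_0 mulr0.
rewrite -ler_pdivrMr // mulrC -[(vnorm2 x)^-1]gtr0_norm ?invr_gt0 //.
rewrite -vnorm2Z scalemxAr.
apply: (ub_le_sup (proj2 (mxnorm2_has_sup A))).
exists ((vnorm2 x)^-1 *: x) => //=.
by rewrite vnorm2Z gtr0_norm ?invr_gt0 // mulVf ?gt_eqF.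
Qed.

Lemma cvg_vnorm2_coord (R : realType) (n : nat) (u : nat -> 'cV[R]_n)
    (x : 'cV[R]_n) :
  (forall i, (fun k => u k i 0) @ \oo --> x i 0)%classic ->
  ((fun k => vnorm2 (u k - x)) @ \oo --> (0 : R))%classic.
Proof.
move=> ux; rewrite -(sqrtr0 R).
apply: (@continuous_cvg _ _ _ _ _
  (fun k => \sum_(i < n) (u k - x) i 0 ^+ 2) Num.sqrt).
  exact: sqrt_continuous.
(* Only the limit becomes a sum; the other zero is the unit of the big operator. *)
have {2}-> : 0 = \sum_(i < n) (0 : R) by rewrite big1.
apply: cvg_big => [|i _]; first exact: add_continuous.
rewrite -[X in (_ --> X)%classic](mulr0 0).
have uxi : ((fun k => (u k - x) i 0) @ \oo --> (0 : R))%classic.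
  have -> : (fun k => (u k - x) i 0) = (fun k => u k i 0 - x i 0).
    by apply/funext => k; rewrite !mxE.
  rewrite -[X in (_ --> X)%classic](subrr (x i 0)).
  by apply: cvgB; [exact: ux|exact: cvg_cst].
exact: (cvgM uxi uxi).
Qed.

(** Completeness of Euclidean space in the form needed for Picard iteration:
each coordinate of [u] is a telescoping series dominated by a geometric one. *)
Lemma vnorm2_geometric_cvg (R : realType) (n : nat) (u : nat -> 'cV[R]_n)
    (c q : R) : 0 <= q -> q < 1 ->
  (forall k, vnorm2 (u k.+1 - u k) <= c * q ^+ k) ->
  exists x : 'cV[R]_n, ((fun k => vnorm2 (u k - x)) @ \oo --> (0 : R))%classic.
Proof.
move=> q0 q1 uc.
have ucvg i : cvgn (fun k => u k i 0).
  have -> : (fun k => u k i 0) =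
      (fun k => u 0%N i 0 + series (telescope (fun k => u k i 0)) k).
    by apply/funext => k; rewrite -eq_sum_telescope.
  apply: is_cvgD; first exact: is_cvg_cst.
  apply: normed_cvg; apply: (@series_le_cvg _ _ (geometric c q)) => [k|k|k|].
  - exact: normr_ge0.
  - exact: le_trans (vnorm2_ge0 _ _ _) (uc k).
  - apply: le_trans (uc k).
    by have := vnorm2_ge_coord _ _ (u k.+1 - u k) i; rewrite !mxE.
  - by apply: is_cvg_geometric_series; rewrite ger0_norm.
exists (\col_i limn (fun k => u k i 0)).
by apply: cvg_vnorm2_coord => i; rewrite mxE; apply: ucvg.
Qed.

(** Picard iteration from [0].  The limit [x] of the iterates [u k] is fixed since
the distance from [T x] to [x] is at most
[q * vnorm2 (u k - x) + vnorm2 (u k.+1 - x)] for every [k], and this tends to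
[0].  Two fixed points are at a distance [d] with [d <= q * d], so [d = 0]. *)
Lemma vnorm2_contraction_fixpoint (R : realType) (n : nat)
    (T : 'cV[R]_n -> 'cV[R]_n) (q : R) : 0 <= q -> q < 1 ->
  (forall x y, vnorm2 (T x - T y) <= q * vnorm2 (x - y)) ->
  exists! x, T x = x.
Proof.
move=> q0 q1 Tq.
pose u k := iter k T 0.
have uc k : vnorm2 (u k.+1 - u k) <= vnorm2 (u 1%N - u 0%N) * q ^+ k.
  elim: k => [|k IHk]; first by rewrite expr0 mulr1.
  by rewrite (le_trans (Tq _ _)) // exprS mulrCA ler_wpM2l.
have [x ux] := vnorm2_geometric_cvg _ _ _ _ _ q0 q1 uc.
have Tx : T x = x.
  apply/eqP; rewrite -subr_eq0; apply/eqP/vnorm2_le0.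
  have bound_cvg : ((fun k => q * vnorm2 (u k - x) + vnorm2 (u k.+1 - x))
      @ \oo --> (0 : R))%classic.
    rewrite -[X in (_ --> X)%classic](addr0 0).
    apply: cvgD; first by rewrite -[X in (_ --> X)%classic](mulr0 q);
      apply: cvgMl_tmp.
    by rewrite (cvg_shiftS (fun k => vnorm2 (u k - x))).
  apply: (cvgr_to_ge bound_cvg); apply: nearW => k.
  rewrite -(subrKA (u k.+1)) (le_trans (vnorm2D _ _ _ _)) // lerD2r.
  by rewrite vnorm2B Tq.
exists x; split=> // y Ty.
apply/eqP; rewrite -subr_eq0; apply/eqP/vnorm2_le0.
rewrite -(pmulr_rle0 (x := 1 - q)) ?subr_gt0 // mulrBl mul1r subr_le0.
by rewrite -{1}Tx -{1}Ty.
Qed.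

Theorem theorem3p1 (R : realType) (n : nat) (A : 'M[R]_n) :
  (exists nu : R, [/\ 0 < nu, nu < 1 & mxnorm2 (1%:M - nu *: A) < 1 - nu]) ->
  forall b : 'cV[R]_n,
    exists! x : 'cV[R]_n, A *m x - absmx x - b = 0.
Proof.
move=> [nu [nu0 _ nuA]] b.
pose T x := (1%:M - nu *: A) *m x + nu *: absmx x + nu *: b.
have T_fix x : A *m x - absmx x - b = 0 <-> T x = x.
  have -> : T x = x - nu *: (A *m x - absmx x - b).
    by rewrite /T mulmxBl mul1mx -scalemxAl !scalerBr !opprD !opprK !addrA.
  split=> [->|/eqP]; first by rewrite scaler0 subr0.
  by rewrite -subr_eq0 addrAC subrr sub0r oppr_eq0 scaler_eq0 gt_eqF //= => /eqP.
have q1 : mxnorm2 (1%:M - nu *: A) + nu < 1 by rewrite -ltrBrDr.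
have q0 : 0 <= mxnorm2 (1%:M - nu *: A) + nu.
  by rewrite addr_ge0 ?mxnorm2_ge0 ?ltW.
have Tq x y : vnorm2 (T x - T y)
    <= (mxnorm2 (1%:M - nu *: A) + nu) * vnorm2 (x - y).
  have -> : T x - T y = (1%:M - nu *: A) *m (x - y)
      + nu *: (absmx x - absmx y).
    by rewrite /T opprD addrACA subrr addr0 opprD addrACA -mulmxBr -scalerBr.
  rewrite (le_trans (vnorm2D _ _ _ _)) // mulrDl lerD ?vnorm2_mulmx //.
  by rewrite vnorm2Z gtr0_norm // ler_pM2l // vnorm2_absmxB.
have [x [Tx x_uniq]] := vnorm2_contraction_fixpoint _ _ T _ q0 q1 Tq.
by exists x; split=> [|y /T_fix /x_uniq]; first exact/T_fix.
Qed.
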